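(* Let $G=(V,E)$ be a directed graph such that $V$ has a partition $(A_1,\dots,A_k)$ into finitely many parts such that each $G[A_i]$ is hereditary in $\mathfrak{In}_1\text{-}\mathfrak{Out}_1$ (for example, each $G[A_i]$ is isomorphic to $(\mathbb Z,<)$, to $(\mathbb N,<)$, to $(\mathbb N,>)$, or to a graph without edges). Then $G\in\mathfrak{In}_2\text{-}\mathfrak{Out}_2$.
   Context: Digraphs $G=(V,E)$, $E\subseteq V\times V$, may be infinite. For $W\subseteq V$, $G[W]=(W,E\cap (W\times W))$ is the induced subgraph. A set $A\subseteq V$ is independent if there is no edge (in either direction) between two distinct elements of $A$. For $n\in\mathbb N$ and $A\subseteq V$, $\mathrm{Out}^G_n(A)$ (resp. $\mathrm{In}^G_n(A)$) is the set of all $v\in V$ such that there is a directed path of length at most $n$ from some point of $A$ to $v$ (resp. from $v$ to some point of $A$); length $0$ is allowed. $G\in\mathfrak{Out}_n$ (resp. $G\in\mathfrak{In}_n$) iff there is an independent $A\subseteq V$ with $V=\mathrm{Out}^G_n(A)$ (resp. $V=\mathrm{In}^G_n(A)$). $G\in\mathfrak{In}_n\text{-}\mathfrak{Out}_k$ iff there is a partition $(V_1,V_2)$ of $V$ (parts may be empty) with $G[V_1]\in\mathfrak{In}_n$ and $G[V_2]\in\mathfrak{Out}_k$. $G$ is hereditary in a class iff all induced subgraphs of $G$ are in that class. $(\mathbb Z,<)$ denotes the digraph with vertex set $\mathbb Z$ in which $(x,y)$ is an edge iff $x<y$; similarly for $(\mathbb N,<)$ and $(\mathbb N,>)$. *)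

(* Defs.v *)
From mathcomp Require Import all_boot all_order all_algebra.
From mathcomp Require Import boolp classical_sets functions.

Set Implicit Arguments.
Unset Strict Implicit.
Unset Printing Implicit Defensive.

Local Open Scope classical_set_scope.

Record digraph : Type := Digraph {
  vertex :> Type;
  edges : set (vertex * vertex)
}.

Arguments edges : clear implicits.

Definition induced (G : digraph) (W : set G) : digraph :=
  @Digraph W [set xy | edges G (val xy.1, val xy.2)].

Definition isomorphic (G H : digraph) : Prop :=
  exists2 f : G -> H, bijective f &
    forall x y : G, edges G (x, y) <-> edges H (f x, f y).

Definition independent (G : digraph) (A : set G) : Prop :=
  forall x y : G, A x -> A y -> x <> y -> ~ edges G (x, y).

(* The vertices of the path are x :: p, so its length is [size p]. Repeated
   vertices are allowed, which does not affect reachability in at most n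
   steps. *)
Definition reach_le (G : digraph) (n : nat) (x y : G) : Prop :=
  exists p : seq G,
    [/\ (size p <= n)%N, path (fun u v : G => (u, v) \in edges G) x p
      & last x p = y].

Definition Out (G : digraph) (n : nat) (A : set G) : set G :=
  [set v | exists2 a, A a & reach_le n a v].

Definition In (G : digraph) (n : nat) (A : set G) : set G :=
  [set v | exists2 a, A a & reach_le n v a].

Definition Out_class (n : nat) (G : digraph) : Prop :=
  exists2 A : set G, independent A & Out n A = [set: G].

Definition In_class (n : nat) (G : digraph) : Prop :=
  exists2 A : set G, independent A & In n A = [set: G].

(* Unlike [classical_sets.partition], the parts may be empty. *)
Definition is_partition (T I : Type) (A : I -> set T) : Prop :=
  \bigcup_i A i = [set: T] /\ trivIset [set: I] A.

Definition In_Out_class (n k : nat) (G : digraph) : Prop :=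
  exists V1 V2 : set G,
    [/\ V1 `|` V2 = [set: G], V1 `&` V2 = set0,
        In_class n (induced V1) & Out_class k (induced V2)].

Definition hereditary (C : digraph -> Prop) (G : digraph) : Prop :=
  forall W : set G, C (induced W).

Definition int_lt : digraph :=
  @Digraph int [set xy | (xy.1 < xy.2)%R].

Definition nat_lt : digraph :=
  @Digraph nat [set xy | (xy.1 < xy.2)%N].

Definition nat_gt : digraph :=
  @Digraph nat [set xy | (xy.1 > xy.2)%N].

(* Main.v *)
Require Import Defs.
From mathcomp Require Import all_boot all_order all_algebra.
From mathcomp Require Import boolp classical_sets functions.
From mathcomp Require Import zify.

(* The induction is the Chvatal-Lovasz construction of a quasi-kernel, run on
   whole parts instead of single vertices.  Split a part A of G as B + C with
   B = In_1(X) and C = Out_1(Y) for independent X in B and Y in C.  Remove from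
   G the set D of vertices of Out_1(Y) outside B, then the remaining vertices of
   In_1(X), and apply the induction hypothesis to the rest, which no longer
   meets A.  If Y' is the independent set obtained on the Out_2 side, no edge
   goes from Y to Y', so Y' together with the points of Y which have no edge
   from Y' is independent; the other points of Y are one step away from Y', so
   that D, being one step away from Y, is reached in two steps.  The In_2 side
   is dual. *)

Set Implicit Arguments.
Unset Strict Implicit.
Unset Printing Implicit Defensive.

Local Open Scope classical_set_scope.

(** * Directed paths of length at most one or two *)

Definition step (G : digraph) (x y : G) : Prop := x = y \/ edges G (x, y).

Lemma reach_le1P (G : digraph) (x y : G) : reach_le 1 x y <-> step x y.
Proof.
split=> [[[|u [|v p]] [//= _ + <-]]|[<-|xy]].
- by left.
- by rewrite andbT inE; right.
- by exists [::].
- by exists [:: y]; split=> //=; rewrite andbT inE.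
Qed.

Lemma reach_le2P (G : digraph) (x y : G) :
  reach_le 2 x y <-> exists2 z, step x z & step z y.
Proof.
split=> [[[|u [|v [|w p]]] [//= _ + <-]]|[z [<-|xz] [<-|zy]]].
- by exists x; left.
- by rewrite andbT inE => xu; exists u; [right|left].
- by case/and3P=> /set_mem xu /set_mem uv _; exists u; right.
- by exists [::].
- by exists [:: y]; split=> //=; rewrite andbT inE.
- by exists [:: z]; split=> //=; rewrite andbT inE.
- by exists [:: z; y]; split=> //=; rewrite andbT !mem_set.
Qed.

(** * Edge reversal, exchanging the In and Out sides *)

Definition reverse (G : digraph) : digraph :=
  @Digraph G [set xy | edges G (xy.2, xy.1)].

Lemma reach_le_reverse (G : digraph) (n : nat) (x y : G) :
  reach_le n x y -> @reach_le (reverse G) n y x.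
Proof.
move=> [p [pn + <-]]; rewrite -rev_path => xp.
(* Since [x :: p] is [rcons (belast x p) (last x p)], the reversed walk starts at [y] and goes on
   with [rev (belast x p)]. *)
exists (rev (belast x p)); split; first by rewrite size_rev size_belast.
  by move: xp; apply: sub_path => u v uv; apply: mem_set; apply: set_mem uv.
by case: p {pn xp} => [|u p] //=; rewrite rev_cons last_rcons.
Qed.

Lemma In_class_reverse (n : nat) (G : digraph) :
  In_class n G <-> Out_class n (reverse G).
Proof.
split=> -[A indA covA]; exists A.
- by move=> x y Ax Ay xy; apply: indA => // /esym.
- apply/seteqP; split=> // v _; have [a Aa va] : In n A v by rewrite covA.
  by exists a => //; apply: reach_le_reverse.
- by move=> x y Ax Ay xy; apply: indA => // /esym.
- apply/seteqP; split=> // v _.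
  have [a Aa /reach_le_reverse av] : @Out (reverse G) n A v by rewrite covA.
  (* reverse (reverse G) is convertible to G once G is a constructor. *)
  by exists a => //; case: (G) A a v av {indA covA Aa}.
Qed.

(** Reversal and passing to an induced subgraph commute up to conversion. *)
Lemma In_class_induced (n : nat) (G : digraph) (S : set G) :
  In_class n (induced S) <-> Out_class n (induced (S : set (reverse G))).
Proof. exact: In_class_reverse. Qed.

(** * Domination by independent sets, expressed inside one ambient graph *)

Definition dominates (G : digraph) (S Y : set G) : Prop :=
  [/\ Y `<=` S, independent Y & forall v, S v -> exists2 y, Y y & step y v].

(** The midpoint [z] is kept in [S] because the path must stay in the induced subgraph. *)
Definition quasi_dominates (G : digraph) (S Y : set G) : Prop :=
  [/\ Y `<=` S, independent Y
    & forall v, S v -> exists y z, [/\ Y y, S z, step y z & step z v]].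

(** The map [f] serves to flatten an induced subgraph of an induced subgraph into a subset of
    [G]. *)
Lemma Out_class1_image (G H : digraph) (f : H -> G) (V : set H) :
    (forall x y, edges H (x, y) <-> edges G (f x, f y)) ->
  Out_class 1 (induced V) -> exists Y, dominates (f @` V) Y.
Proof.
move=> fE [A indA covA]; exists (f @` (val @` A)); split.
- by move=> _ [_ [a _ <-] <-]; exists (val a) => //; apply: set_mem (valP a).
- move=> _ _ [_ [a Aa <-] <-] [_ [b Ab <-] <-] ab /fE.
  by apply: indA => // eab; apply: ab; rewrite eab.
- move=> _ [v Vv <-].
  have [a Aa /reach_le1P av] : Out 1 A (SigSub (mem_set Vv)) by rewrite covA.
  exists (f (val a)); first by exists (val a) => //; exists a.
  by case: av => [->|/fE av]; [left|right].
Qed.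

Lemma dominates_Out_class (G : digraph) (S Y : set G) :
  dominates S Y -> Out_class 1 (induced S).
Proof.
move=> [YS indY domY]; exists (val @^-1` Y).
  move=> x y Yx Yy xy; apply: indY => // exy.
  by apply: xy; apply: val_inj.
apply/seteqP; split=> // v _.
have [y Yy yv] := domY _ (set_mem (valP v)).
exists (SigSub (mem_set (YS _ Yy))) => //; apply/reach_le1P.
by case: yv => [yv|yv]; [left; apply: val_inj|right].
Qed.

Lemma quasi_dominates_Out_class (G : digraph) (S Y : set G) :
  quasi_dominates S Y -> Out_class 2 (induced S).
Proof.
move=> [YS indY domY]; exists (val @^-1` Y).
  move=> x y Yx Yy xy; apply: indY => // exy.
  by apply: xy; apply: val_inj.
apply/seteqP; split=> // v _.
have [y [z [Yy Sz yz zv]]] := domY _ (set_mem (valP v)).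
exists (SigSub (mem_set (YS _ Yy))) => //; apply/reach_le2P.
exists (SigSub (mem_set Sz)).
  by case: yz => [yz|yz]; [left; apply: val_inj|right].
by case: zv => [zv|zv]; [left; apply: val_inj|right].
Qed.

(** * Induction over the parts *)

Lemma quasi_dominatesU (G : digraph) (S Y' D Y : set G) :
    quasi_dominates S Y' -> dominates D Y ->
    (forall y s, Y y -> S s -> ~ step y s) ->
  exists Z, quasi_dominates (S `|` D) Z.
Proof.
move=> [Y'S indY' domS] [YD indY domD] noYS.
exists (Y' `|` [set y | Y y /\ ~ exists2 y', Y' y' & edges G (y', y)]); split.
- by move=> v [/Y'S|[/YD]]; [left|right].
- move=> u v [Y'u|[Yu nu]] [Y'v|[Yv nv]] uv.
  + exact: indY'.
  + by move=> e; apply: nv; exists u.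
  + by move=> e; apply: (noYS u v Yu (Y'S _ Y'v)); right.
  + exact: indY.
- move=> v [/domS [y [z [Y'y Sz yz zv]]]|/domD [y Yy yv]].
    by exists y, z; split=> //; left.
  have [[y' Y'y' y'y]|ny] := pselect (exists2 y', Y' y' & edges G (y', y)).
    exists y', y; split=> //; [by left|by right; apply: YD|by right].
  exists y, y; split=> //; [by right|by right; apply: YD|by left].
Qed.

(** Heredity enters here: at each stage of the induction only the trace [W] of the part [A] on the
    remaining vertices is split. *)
Lemma hereditary_split (G : digraph) (A W : set G) :
    hereditary (In_Out_class 1 1) (induced A) -> W `<=` A ->
  exists B C, [/\ B `|` C = W, B `&` C = set0,
    exists X, @dominates (reverse G) B X & exists Y, dominates C Y].
Proof.
move=> hA WA; have [V1 [V2 [V12 V0 in1 out2]]] := hA (val @^-1` W).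
pose f (u : induced (val @^-1` W : set (induced A))) : G := val (val u).
have f_inj : injective f by move=> u v /val_inj/val_inj.
exists (f @` V1), (f @` V2); split.
- rewrite -image_setU V12; apply/seteqP; split=> [_ [u _ <-]|w Ww].
    exact: (set_mem (valP u)).
  pose u : induced A := SigSub (mem_set (WA w Ww)).
  by exists (SigSub (mem_set (Ww : (val @^-1` W) u))).
- apply/seteqP; split=> // _ [[u V1u <-] [v V2v /f_inj vu]].
  by have : (V1 `&` V2) u; [split=> //; rewrite -vu|rewrite V0].
- exact/(@Out_class1_image (reverse G) (reverse _) f V1)/In_class_induced.
- exact: Out_class1_image out2.
Qed.

(** [W] is arbitrary so that the induction on [k] applies to the vertices left after a removal;
    indexing by [nat] lets [A] stay fixed as [k] drops. *)
Lemma hereditary_cover_In_Out22 (G : digraph) (k : nat) (A : nat -> set G)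
    (W : set G) :
    (forall i, (i < k)%N -> hereditary (In_Out_class 1 1) (induced (A i))) ->
    (forall w, W w -> exists2 i, (i < k)%N & A i w) ->
  exists V1 V2, [/\ V1 `|` V2 = W, V1 `&` V2 = set0,
    exists X, @quasi_dominates (reverse G) V1 X
    & exists Y, quasi_dominates V2 Y].
Proof.
elim: k W => [|k IHk] W hA WA.
  have W0 : W = set0 by apply/seteqP; split=> // w /WA[].
  exists set0, set0; rewrite setU0 setI0 W0.
  by split=> //; exists set0; split.
have [B [C [BC BC0 [X domX] [Y domY]]]] :=
  hereditary_split (hA k (ltnSn k)) (@subIsetr _ W (A k)).
have BCP v : W v -> A k v -> B v \/ C v.
  by move=> Wv Av; have : (W `&` A k) v by []; rewrite -BC.
have BW v : B v -> W v.
  by move=> Bv; have [] : (W `&` A k) v by rewrite -BC; left.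
have CW v : C v -> W v.
  by move=> Cv; have [] : (W `&` A k) v by rewrite -BC; right.
have BnC v : B v -> ~ C v.
  by move=> Bv Cv; have : (B `&` C) v by []; rewrite BC0.
have [XB indX covX] := domX; have [YC indY covY] := domY.
(* Leaving [B] out of [D] keeps [X] inside [F], even at points of [X] within one step of [Y]. *)
pose D := [set w | [/\ W w, ~ B w & exists2 y, Y y & step y w]].
pose F := [set w | [/\ W w, ~ D w
                     & exists2 x, X x & @step (reverse G) x w]].
have CD v : C v -> D v.
  by move=> Cv; split; [exact: CW|move/BnC|exact: covY].
have BF v : B v -> F v.
  by move=> Bv; split; [exact: BW|case|exact: covX].
have [||V1 [V2 [V12 V0 [X' qX'] [Y' qY']]]] := IHk (W `\` (D `|` F)).
- by move=> i ik; apply: hA; apply: ltnW.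
- move=> w [Ww nDF]; have [i + Aiw] := WA w Ww.
  rewrite ltnS leq_eqVlt => /predU1P[ik|ik]; last by exists i.
  rewrite ik in Aiw; case: nDF.
  by have [/BF|/CD] := BCP w Ww Aiw; [right|left].
have V1P v : V1 v -> [/\ W v, ~ D v & ~ F v].
  move=> V1v; have [Wv nDF] : (W `\` (D `|` F)) v by rewrite -V12; left.
  by split=> // [Dv|Fv]; apply: nDF; [left|right].
have V2P v : V2 v -> [/\ W v, ~ D v & ~ F v].
  move=> V2v; have [Wv nDF] : (W `\` (D `|` F)) v by rewrite -V12; right.
  by split=> // [Dv|Fv]; apply: nDF; [left|right].
exists (V1 `|` F), (V2 `|` D); split.
- apply/seteqP; split=> [v [[/V1P[]|[]]|[/V2P[]|[]]] //|v Wv].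
  have [Dv|nD] := pselect (D v); first by right; right.
  have [Fv|nF] := pselect (F v); first by left; right.
  have : (V1 `|` V2) v by rewrite V12; split=> // -[].
  by case; [left; left|right; left].
- apply/seteqP; split=> // v [[V1v|Fv] [V2v|Dv]].
  + by have : (V1 `&` V2) v; [|rewrite V0].
  + by have [_ /(_ Dv)] := V1P v V1v.
  + by have [_ _ /(_ Fv)] := V2P v V2v.
  + by case: Fv => _ /(_ Dv).
- apply: (quasi_dominatesU qX' (Y := X)); first split=> //.
  + by move=> x /XB/BF.
  + by move=> v [].
  + move=> x s Xx /V1P[Ws nDs nFs] xs; apply: nFs.
    by split=> //; exists x.
- apply: (quasi_dominatesU qY' (Y := Y)); first split=> //.
  + by move=> y /YC/CD.
  + by move=> v [].
  (* [s] is outside [F], hence outside [B], so a step from [y] would put it in [D]. *)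
  + move=> y s Yy /V2P[Ws nDs nFs] ys; apply: nDs.
    by split=> // [/BF|] //; exists y.
Qed.

(** * The examples: sets of integers under the strict order, and edgeless graphs *)

Lemma dominates_set1 (G : digraph) (S : set G) (y : G) :
  S y -> (forall v, S v -> step y v) -> dominates S [set y].
Proof.
move=> Sy domS; split=> [_ -> //|_ _ -> -> //|v /domS yv].
by exists y.
Qed.

Lemma Out_class_set0 (G : digraph) : Out_class 1 (induced (set0 : set G)).
Proof. by apply: (@dominates_Out_class G set0 set0); split. Qed.

(* Cut the image of f at any of its points f w: f w is the maximum of the lower
   part, and the upper part is bounded below in int, so has a minimum. *)
Lemma int_embedded_In_Out11 (H : digraph) (f : H -> int) :
    injective f -> (forall x y, edges H (x, y) <-> (f x < f y)%R) ->
  In_Out_class 1 1 H.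
Proof.
move=> f_inj fE.
have fstep x y : (f x <= f y)%R -> step x y.
  by rewrite Order.POrderTheory.le_eqVlt => /predU1P[/f_inj|/fE]; [left|right].
(* An induced subgraph may be empty, and then there is no point to cut at. *)
have [[w _]|H0] := pselect (exists w : H, True); last first.
  exists set0, set0; split.
  - by apply/seteqP; split=> // x _; case: H0; exists x.
  - by rewrite setI0.
  - exact/In_class_induced/(@Out_class_set0 (reverse H)).
  - exact: Out_class_set0.
exists [set x | (f x <= f w)%R], [set x | (f w < f x)%R]; split.
- apply/seteqP; split=> // x _ /=.
  by case: (Order.TotalTheory.leP (f x) (f w)); [left|right].
- by apply/seteqP; split=> // x [/=]; lia.
- apply/In_class_induced/(@dominates_Out_class (reverse H) _ [set w]).
  apply: dominates_set1 => [/=|v /fstep [->|vw]]; [lia|by left|by right].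
(* Values above [f w] are counted from [f w + 1], so that the least [n] satisfying [P] gives the
   minimum of the upper part. *)
pose P n := `[< exists x, f x = (f w + n.+1%:Z)%R >].
have [[x wx]|noP] := pselect (exists x, (f w < f x)%R); last first.
  rewrite (_ : [set x | _] = set0); first exact: Out_class_set0.
  by apply/seteqP; split=> // x wx; case: noP; exists x.
have exP : exists n, P n.
  by exists `|f x - f w|%N.-1; apply/asboolP; exists x; lia.
case: (ex_minnP exP) => m /asboolP[y fy] min_m.
apply: (@dominates_Out_class _ _ [set y]).
apply: dominates_set1 => [/=|v /= wv]; first by lia.
apply: fstep; have /min_m : P `|f v - f w|%N.-1 by apply/asboolP; exists v; lia.
lia.
Qed.

(** An embedding into the integers restricts to every set of vertices, so one argument serves all
    three orders. *)
Lemma int_embedded_hereditary (H : digraph) (f : H -> int) :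
    injective f -> (forall x y, edges H (x, y) <-> (f x < f y)%R) ->
  hereditary (In_Out_class 1 1) H.
Proof.
move=> f_inj fE W.
apply: (@int_embedded_In_Out11 (induced W) (f \o val)) => [|x y].
  exact: inj_comp val_inj.
exact: fE.
Qed.

Lemma edgeless_In_Out11 (H : digraph) :
  (forall x y : H, ~ edges H (x, y)) -> In_Out_class 1 1 H.
Proof.
move=> noE; exists set0, setT; split; rewrite ?set0U ?set0I //.
  exact/In_class_induced/(@Out_class_set0 (reverse H)).
apply: (@dominates_Out_class _ _ setT); split=> // v _.
by exists v => //; left.
Qed.

Theorem corollary2p6 :
  (forall (G : digraph) (k : nat) (A : 'I_k -> set G),
     is_partition A ->
     (forall i : 'I_k, hereditary (In_Out_class 1 1) (induced (A i))) ->
     In_Out_class 2 2 G) /\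
  (forall H : digraph,
     [\/ isomorphic H int_lt, isomorphic H nat_lt, isomorphic H nat_gt
       | exists2 H0 : digraph, edges H0 = set0 & isomorphic H H0] ->
     hereditary (In_Out_class 1 1) H).
Proof.
split=> [G k A [covA _] hA|H].
  (* Indices from [k] on get the empty set as a default; only those below [k] matter. *)
  pose A' n := if insub n is Some i then A i else set0.
  have A'E (i : 'I_k) : A' i = A i by rewrite /A' valK.
  have [||V1 [V2 [V12 V0 [X qX] [Y qY]]]] :=
    @hereditary_cover_In_Out22 G k A' setT.
  - by move=> i ik; rewrite (A'E (Ordinal ik)).
  - move=> w _; have [i _ Aiw] : (\bigcup_i A i) w by rewrite covA.
    by exists i; rewrite ?A'E.
  exists V1, V2; split=> //; last exact: quasi_dominates_Out_class qY.
  exact/In_class_induced/(@quasi_dominates_Out_class (reverse G) V1 X).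
move=> [[f /bij_inj f_inj fE]|[f /bij_inj f_inj fE]|[f /bij_inj f_inj fE]
  |[H0 E0 [f _ fE]]].
- exact: (int_embedded_hereditary f_inj).
- apply: (@int_embedded_hereditary _ (fun x => Posz (f x))).
    by move=> x y [/f_inj].
  by move=> x y; rewrite fE /=; lia.
(* Negation turns the order [>] of the naturals into the order [<] of the integers. *)
- apply: (@int_embedded_hereditary _ (fun x => - Posz (f x))%R).
    by move=> x y exy; apply: f_inj; lia.
  by move=> x y; rewrite fE /=; lia.
- by move=> W; apply: edgeless_In_Out11 => x y /fE; rewrite E0.
Qed.
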